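(* Let $n\ge 1$, let $A,B\in M_n(\mathbb{C})$ be positive semidefinite matrices, let $j\in\{1,\ldots,n\}$, and let $0\le s\le 1$. Then $$\sigma_j\bigl(A^s B^{1-s} + A^{1-s} B^s\bigr) \;\le\; \sigma_j(A+B).$$
   Context: $M_n(\mathbb{C})$ denotes the complex $n\times n$ matrices. For $X\in M_n(\mathbb{C})$, $\sigma_1(X)\ge\sigma_2(X)\ge\cdots\ge\sigma_n(X)$ denote the singular values of $X$ sorted in non-increasing order (with multiplicity). For a positive semidefinite matrix $A$ and $s\ge 0$, the power $A^s$ is defined by the functional calculus applied to $x\mapsto x^s$ on $[0,\infty)$ (with $x^0=1$, so $A^0$ is the identity). *)

(* Defs.v *)
From HB Require Import structures.
From mathcomp Require Import all_boot all_order all_algebra.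
From mathcomp Require Import complex.
From mathcomp Require Import all_classical all_reals all_analysis.

Set Implicit Arguments.
Unset Strict Implicit.
Unset Printing Implicit Defensive.

Import Order.TTheory GRing.Theory Num.Theory.

Local Open Scope ring_scope.
Local Open Scope sesquilinear_scope.
Local Open Scope complex_scope.

(* The order on R[i] is partial, [0 <= z] meaning that z is a nonnegative
   real number. *)
Definition psdmx (R : realType) (n : nat) (A : 'M[R[i]]_n) : Prop :=
  A \is hermsymmx /\ forall v : 'cV[R[i]]_n, 0 <= (v ^t* *m A *m v) 0 0.

(* For a Hermitian A, [spectralmx A] is unitary, [spectral_diag A] is real, and
   A is [invmx (spectralmx A) *m diag_mx (spectral_diag A) *m spectralmx A]
   (lemmas [orthomx_spectralP] and [hermitian_spectral_diag_real]). The
   definition is only meaningful for Hermitian A. *)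
Definition mxfuncalc (R : realType) (n : nat) (f : R -> R) (A : 'M[R[i]]_n) :
    'M[R[i]]_n :=
  invmx (spectralmx A)
    *m diag_mx (map_mx (fun z : R[i] => (f (complex.Re z))%:C) (spectral_diag A))
    *m spectralmx A.

(* In the library [0 `^ 0 = 1], and [0 `^ s = 0] for [s != 0]. *)
Definition mxpowR (R : realType) (n : nat) (A : 'M[R[i]]_n) (s : R) :
    'M[R[i]]_n :=
  mxfuncalc (fun x : R => powR x s) A.

(* The square roots of the eigenvalues of X^* X, with multiplicity, in
   non-increasing order. *)
Definition singular_values (R : realType) (n : nat) (X : 'M[R[i]]_n) : seq R :=
  sort (fun x y : R => y <= x)
    [seq Num.sqrt (complex.Re (spectral_diag (X ^t* *m X) 0 i)) | i : 'I_n].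

(* Numbered from 1: this is the j-th largest singular value
   for [1 <= j <= n]. *)
Definition singular_value (R : realType) (n : nat) (X : 'M[R[i]]_n) (j : nat) :
    R :=
  nth 0 (singular_values X) j.-1.

(* Main.v *)
(* Audenaert's argument.  For f operator monotone, P and Q positive semidefinite
   and S = (P + Q)^(1/2), one has S (f(P) + f(Q)) S <= 2 (P f(P) + Q f(Q)): for
   f(x) = x/(x + tau) this reduces to the operator convexity of the inverse, and
   x^r, 0 < r < 1, is a limit of positive combinations of such functions.  With
   P = A^t, Q = B^t and r = (1 - t)/t, 1/2 <= t <= 1, this reads
   S (A^(1-t) + B^(1-t)) S <= 2 (A + B).
   Let X_t = [A^(t/2)  B^(t/2)], so that X_t X_t^* = A^t + B^t = S^2; the operator
   on the left has the nonzero eigenvalues of T^* T with T = X_t^* X_(1-t), and of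
   T T^*.  The off-diagonal blocks of T^* T and T T^* are the matrices
   A^s B^(1-s) + A^(1-s) B^s with s = (1-t)/2 and s = t/2, and twice the j-th
   singular value of an off-diagonal block of a positive semidefinite 2 x 2 block
   matrix is at most its j-th eigenvalue. *)
Require Import Defs.
From mathcomp Require Import all_boot all_order all_algebra.
From mathcomp Require Import complex.
From mathcomp Require Import all_classical all_reals all_analysis.
From mathcomp Require Import ring lra.

Set Implicit Arguments.
Unset Strict Implicit.
Unset Printing Implicit Defensive.

Import Order.TTheory GRing.Theory Num.Theory numFieldNormedType.Exports.

Local Open Scope ring_scope.

(** * Powers as limits of combinations of the functions x / (x + t) *)

Section PowerSeries.
Variable R : realType.
Implicit Types (x t w v : R) (k : nat).

Definition resolvent_ratio t x : R := x / (x + t).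

Lemma resolvent_ratio_ge0 t x : 0 < t -> 0 <= x -> 0 <= resolvent_ratio t x.
Proof. by move=> t0 x0; rewrite divr_ge0// addr_ge0// ltW. Qed.

Lemma resolvent_ratio_le1 t x : 0 < t -> 0 <= x -> resolvent_ratio t x <= 1.
Proof.
by move=> t0 x0; rewrite ler_pdivrMr ?ltr_wpDl// mul1r lerDl ltW.
Qed.

Lemma resolvent_ratio_le t x : 0 < t -> 0 <= x -> resolvent_ratio t x <= x / t.
Proof.
move=> t0 x0; rewrite ler_wpM2l// lef_pV2 ?posrE ?ltr_wpDl//.
by rewrite lerDr.
Qed.

Lemma resolvent_ratio_mono t x y :
  0 < t -> 0 <= x -> x <= y -> resolvent_ratio t x <= resolvent_ratio t y.
Proof.
move=> t0 x0 xy; have y0 := le_trans x0 xy.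
rewrite ler_pdivrMr ?ltr_wpDl// mulrAC ler_pdivlMr ?ltr_wpDl//.
by rewrite !mulrDr [y * x]mulrC lerD2l ler_wpM2r// ltW.
Qed.

Lemma resolvent_ratio_scale c t x : c != 0 ->
  resolvent_ratio (c * t) (c * x) = resolvent_ratio t x.
Proof. by move=> c0; rewrite /resolvent_ratio -mulrDr -mulf_div divff// mul1r. Qed.

Variables (w v : R).
Hypotheses (v1 : 1 < v) (vw : v < w).

Let v0 : 0 < v. Proof. exact: lt_trans v1. Qed.
Let w0 : 0 < w. Proof. exact: lt_trans vw. Qed.
Let w_neq0 : w != 0. Proof. exact: lt0r_neq0. Qed.
Let v_neq0 : v != 0. Proof. exact: lt0r_neq0. Qed.

(** The two halves of a bilateral series over the points [w ^ k]; the exponent [k.+1] in [down]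
    keeps the point 1 from being counted twice. *)
Let up x k : R := v ^+ k * resolvent_ratio (w ^+ k) x.
Let down x k : R := v^-1 ^+ k.+1 * resolvent_ratio (w^-1 ^+ k.+1) x.

(* With [v = w `^ r], a Riemann sum, up to a constant factor, for
   [x `^ r = C * \int_0^oo x / (x + t) * t `^ (r - 1) dt] at the points [t = w ^ k]. *)
Definition lattice_power x : R := limn (series (up x)) + limn (series (down x)).

Let up_ge0 x k : 0 <= x -> 0 <= up x k.
Proof.
by move=> x0; rewrite mulr_ge0 ?resolvent_ratio_ge0 ?exprn_ge0 ?exprn_gt0// ltW.
Qed.

Let down_ge0 x k : 0 <= x -> 0 <= down x k.
Proof.
move=> x0.
by rewrite mulr_ge0 ?resolvent_ratio_ge0 ?exprn_ge0 ?exprn_gt0 ?invr_ge0 ?invr_gt0// ltW.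
Qed.

(** Since [x / (x + w ^ k) <= x / w ^ k], the terms are dominated by a geometric series of ratio
    [v / w < 1]. *)
Let up_cvg x : 0 <= x -> cvgn (series (up x)).
Proof.
move=> x0.
have vw1 : 0 <= v / w by rewrite divr_ge0 // ltW.
apply: (@series_le_cvg _ _ (geometric x (v / w))).
- by move=> k; exact: up_ge0.
- by move=> k; rewrite /= mulr_ge0// exprn_ge0.
- move=> k; rewrite /= expr_div_n mulrCA ler_wpM2l ?exprn_ge0 ?(ltW v0)//.
  by rewrite resolvent_ratio_le// exprn_gt0.
- by apply: is_cvg_geometric_series; rewrite ger0_norm// ltr_pdivrMr// mul1r.
Qed.

Let down_cvg x : 0 <= x -> cvgn (series (down x)).
Proof.
move=> x0.
have vi : 0 <= v^-1 by rewrite invr_ge0 ltW.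
apply: (@series_le_cvg _ _ (geometric v^-1 v^-1)).
- by move=> k; exact: down_ge0.
- by move=> k; rewrite /= mulr_ge0// exprn_ge0.
- move=> k; rewrite /= -exprS ler_piMr ?exprn_ge0//.
  by rewrite resolvent_ratio_le1// exprn_gt0 ?invr_gt0.
- by apply: is_cvg_geometric_series; rewrite ger0_norm// invf_lt1.
Qed.

Lemma lattice_power_mono x y : 0 <= x -> x <= y ->
  lattice_power x <= lattice_power y.
Proof.
move=> x0 xy; have y0 := le_trans x0 xy.
apply: lerD.
  apply: lim_series_le (up_cvg x0) (up_cvg y0) _ => k.
  rewrite ler_wpM2l ?exprn_ge0 ?(ltW v0)//.
  by rewrite resolvent_ratio_mono// exprn_gt0.
apply: lim_series_le (down_cvg x0) (down_cvg y0) _ => k.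
rewrite ler_wpM2l ?exprn_ge0 ?invr_ge0 ?(ltW v0)//.
by rewrite resolvent_ratio_mono// exprn_gt0// invr_gt0.
Qed.

Lemma lattice_power0 : lattice_power 0 = 0.
Proof.
have series0 (u : nat -> R) : (forall k, u k = 0) -> limn (series u) = 0.
  move=> u0; have -> : series u = fun=> 0; last by rewrite lim_cst.
  by apply/funext => n; rewrite /series/= big1.
by rewrite /lattice_power !series0 ?addr0// => k;
  rewrite /up /down /resolvent_ratio mul0r mulr0.
Qed.

Lemma lattice_power1_gt0 : 0 < lattice_power 1.
Proof.
apply: ltr_pwDl; last first.
  apply: limr_ge; first exact: down_cvg.
  by apply: nearW => n; apply: sumr_ge0 => k _; exact: down_ge0.
apply: (@lt_le_trans _ _ (up 1 0)).
  by rewrite /up /resolvent_ratio !expr0 mul1r divr_gt0 ?addr_gt0.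
apply: limr_ge; first exact: up_cvg.
near=> n.
have n0 : (0 < n)%N by near: n; exact: nbhs_infty_gt.
rewrite /series/= -(prednK n0) big_nat_recl// lerDl.
by apply: sumr_ge0 => k _; exact: up_ge0.
Unshelve. all: by end_near. Qed.

(** The term at the point [w^-1]: it is the first term of [down x], and scaling [x] by [w] moves it
    into the [up] half. *)
Let shift_term x : R := v^-1 * resolvent_ratio w^-1 x.

Let up_shift x : 0 <= x ->
  limn (series (up (w * x))) = v * (shift_term x + limn (series (up x))).
Proof.
move=> x0.
have wx0 : 0 <= w * x by rewrite mulr_ge0// ltW.
apply/cvg_lim => //.
rewrite -cvg_shiftS.
rewrite (_ : [sequence _]_n = fun n => v * (shift_term x + series (up x) n)).
  apply: cvgMr; apply: cvgD; [exact: cvg_cst|exact: up_cvg].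
apply/funext => n; rewrite /series /= big_nat_recl//.
rewrite mulrDr; congr (_ + _).
  rewrite /up /shift_term !expr0 mul1r mulVKf//.
  by rewrite -[RHS](@resolvent_ratio_scale w)// divff.
rewrite big_distrr; apply: eq_bigr => k _ /=.
by rewrite /up exprS -mulrA exprS resolvent_ratio_scale.
Qed.

Let down_shift x : 0 <= x ->
  limn (series (down (w * x))) = v * (limn (series (down x)) - shift_term x).
Proof.
move=> x0.
have wx0 : 0 <= w * x by rewrite mulr_ge0// ltW.
apply/cvg_lim => //.
have -> : series (down (w * x)) =
    [sequence v * (series (down x) n.+1 - shift_term x)]_n.
  apply/funext => n; rewrite /series /= [in RHS]big_nat_recl//.
  rewrite {2}/down !expr1 -/(shift_term x) addrAC subrr add0r.
  rewrite big_distrr; apply: eq_bigr => k _ /=.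
  rewrite /down -[in RHS](@resolvent_ratio_scale w)//.
  have cancel (c : R) : c != 0 -> c * c^-1 ^+ k.+2 = c^-1 ^+ k.+1.
    by move=> c0; rewrite [in LHS]exprS mulVKf.
  by rewrite [RHS]mulrA !cancel.
apply: cvgMr; apply: cvgB; last exact: cvg_cst.
by rewrite cvg_shiftS; exact: down_cvg.
Qed.

(** Scaling [x] by [w] shifts the bilateral series by one index, which multiplies it by [v]; the
    term that crosses from one half to the other cancels. *)
Lemma lattice_power_scale x : 0 <= x ->
  lattice_power (w * x) = v * lattice_power x.
Proof. by move=> x0; rewrite /lattice_power up_shift// down_shift//; ring. Qed.

Lemma lattice_powerX (m : int) : lattice_power (w ^ m) = v ^ m * lattice_power 1.
Proof.
have scaleX n x : 0 <= x -> lattice_power (w ^+ n * x) = v ^+ n * lattice_power x.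
  move=> x0; elim: n => [|n IHn]; first by rewrite !expr0 !mul1r.
  by rewrite !exprS -!mulrA lattice_power_scale ?IHn// mulr_ge0// exprn_ge0// ltW.
case: m => n.
  by rewrite -!exprnP -[in LHS](mulr1 (w ^+ n)) scaleX.
rewrite NegzE -!exprnN.
apply: (mulfI (expf_neq0 n.+1 v_neq0)); rewrite -scaleX ?invr_ge0 ?exprn_ge0 ?(ltW w0)//.
by rewrite divff ?expf_neq0// mulVKf// expf_neq0.
Qed.

(** Each partial sum is a nonnegative combination of ratios [x / (x + t)], so the inequality holds
    for it and survives the limit. *)
Lemma lattice_power_cone (I : finType) (c x : I -> R) :
  (forall i, 0 <= x i) ->
  (forall t, 0 < t -> 0 <= \sum_i c i * resolvent_ratio t (x i)) ->
  0 <= \sum_i c i * lattice_power (x i).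
Proof.
move=> x0 cx.
have cvg_partial : (\sum_i c i * (series (up (x i)) n + series (down (x i)) n)
    @[n --> \oo] --> \sum_i c i * lattice_power (x i))%classic.
  apply: cvg_big => [|i _]; first exact: add_continuous.
  by apply: cvgMr; apply: cvgD; [exact: up_cvg|exact: down_cvg].
rewrite -(cvg_lim _ cvg_partial)//.
apply: limr_ge; first by apply/cvg_ex; eexists; exact: cvg_partial.
apply: nearW => n.
under eq_bigr do rewrite /series/= -big_split/= big_distrr/=.
rewrite exchange_big/=; apply: sumr_ge0 => k _.
under eq_bigr do rewrite mulrDr /up /down !(mulrCA (c _) (_ ^+ _)).
rewrite big_split/= -!big_distrr/= addr_ge0// mulr_ge0 ?exprn_ge0 ?invr_ge0 ?(ltW v0)//.
  by apply: cx; rewrite exprn_gt0.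
by apply: cx; rewrite exprn_gt0// invr_gt0.
Qed.

End PowerSeries.

(** * Linear inequalities pass from the ratios x / (x + t) to powers *)

Section PowerCone.
Variable R : realType.

Lemma sumr_ge0_approx (I : finType) (c f : I -> R) :
  (forall i, 0 <= f i) ->
  (forall e, 0 < e -> exists2 g : I -> R,
     forall i, `|g i - f i| <= e * f i & 0 <= \sum_i c i * g i) ->
  0 <= \sum_i c i * f i.
Proof.
move=> f0 approx; rewrite leNgt; apply/negP => lt0.
set M := \sum_i `|c i| * f i.
have M0 : 0 <= M by apply: sumr_ge0 => i _; rewrite mulr_ge0.
set L := \sum_i c i * f i in lt0 *.
(* With this relative error the two sums differ by at most [e * M <= - L / 2], so the approximating
   sum would be negative too. The [+ 1] keeps the denominator positive when [M] is 0. *)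
have e0 : 0 < - L / (M + 1) / 2 by rewrite !divr_gt0 ?oppr_gt0// ltr_wpDl.
have [g gf] := approx _ e0.
suff : \sum_i c i * g i - L <= - L / 2 by lra.
rewrite /L -sumrB.
apply: (@le_trans _ _ (\sum_i - L / (M + 1) / 2 * (`|c i| * f i))).
  apply: ler_sum => i _; rewrite -mulrBr; apply: le_trans (ler_norm _) _.
  by rewrite normrM mulrCA ler_wpM2l.
rewrite -big_distrr/= -/M -!mulrA ler_wpM2l// ?oppr_ge0 ?ltW//.
by rewrite ltr_pdivrMl ?ltr_wpDl//; lra.
Qed.

Lemma powR_gt1 (a r : R) : 1 < a -> 0 < r -> 1 < a `^ r.
Proof.
move=> a1 r0; rewrite -[X in X < _](congr1 (@^~ r) (powR1 R)).
by rewrite gt0_ltr_powR ?nnegrE// ltW// (lt_trans _ a1).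
Qed.

Lemma powR_lt (a r : R) : 1 < a -> r < 1 -> a `^ r < a.
Proof.
move=> a1 r1; have a0 := lt_trans ltr01 a1.
rewrite -[ltRHS]powRr1 ?(ltW a0)// -[X in _ < _ `^ X](subrKC r) powRD.
  by rewrite ltr_pMr ?powR_gt0// powR_gt1// subr_gt0.
by rewrite (gt_eqF a0) implybT.
Qed.

(* On [w ^ m <= x <= w ^ (m + 1)] both terms lie between [v ^ m] and
   [v ^ (m + 1)], where [v = w `^ r]. *)
Lemma lattice_power_approx (w r x : R) : 1 < w -> 0 < r < 1 -> 0 <= x ->
  `|lattice_power w (w `^ r) x / lattice_power w (w `^ r) 1 - x `^ r|
    <= (w `^ r - 1) * x `^ r.
Proof.
move=> w1 /andP[r0 r1] x0; set v := w `^ r; set S := lattice_power w v.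
have w0 : 0 < w by lra.
have v1 : 1 < v by exact: powR_gt1.
have vw : v < w by exact: powR_lt.
have S1 : 0 < S 1 by exact: lattice_power1_gt0.
have [->|xn0] := eqVneq x 0.
  by rewrite /S lattice_power0// powR0 ?gt_eqF// mul0r subrr normr0 mulr0.
have xp : 0 < x by rewrite lt_neqAle eq_sym xn0.
(* The integer part of the logarithm of [x] to base [w], which places [x] between [w ^ m] and
   [w ^ (m + 1)]. *)
pose m := Num.floor (ln x / ln w).
have /andP[mx xm] := floor_itv (ln x / ln w).
have lw : 0 < ln w by rewrite ln_gt0.
have wm : w ^ m <= x.
  rewrite -powR_intmul ?(ltW w0)// -[leRHS]lnK ?posrE// /powR gt_eqF// ler_expR.
  by rewrite -ler_pdivlMr.
have wm1 : x <= w ^ (m + 1).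
  rewrite -powR_intmul ?(ltW w0)// -[leLHS]lnK ?posrE// /powR gt_eqF// ler_expR.
  by rewrite -ler_pdivrMr// ltW.
have wr (k : int) : (w ^ k) `^ r = v ^ k.
  rewrite -(powR_intmul _ (ltW w0)) -(powR_intmul _ (powR_ge0 w r)).
  by rewrite /v -!powRrM mulrC.
have vm := @ge0_ler_powR _ r (ltW r0) _ _ (exprz_ge0 m (ltW w0)) x0 wm.
have vm1 := @ge0_ler_powR _ r (ltW r0) _ _ x0 (exprz_ge0 (m + 1) (ltW w0)) wm1.
rewrite !wr in vm vm1.
have Sm : v ^ m <= S x / S 1.
  rewrite ler_pdivlMr// -lattice_powerX//.
  by apply: lattice_power_mono => //; rewrite exprz_ge0 ?ltW.
have Sm1 : S x / S 1 <= v ^ (m + 1).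
  rewrite ler_pdivrMr// -lattice_powerX//.
  by apply: lattice_power_mono.
have v_m1 : v ^ (m + 1) = v * v ^ m.
  by rewrite exprzDr ?unitfE ?gt_eqF ?(lt_trans _ v1)// expr1z mulrC.
rewrite v_m1 in vm1 Sm1.
have v10 : 0 <= v - 1 by rewrite subr_ge0 ltW.
have := ler_wpM2l v10 vm; rewrite !mulrBl !mul1r => vVX.
move: (x `^ r) (v ^ m) (S x / S 1) vm vm1 Sm Sm1 vVX => X V Q vm vm1 Sm Sm1 vVX.
rewrite ler_norml; move: (v * X) (v * V) vm1 Sm1 vVX => vX vV.
clear -vm Sm => *; apply/andP; split; lra.
Qed.

(** Meant for [x] listing eigenvalues and [c] built from spectral weights: a quadratic form
    inequality for all the ratios then yields one for powers. *)
Lemma powR_cone (I : finType) (c x : I -> R) (r : R) : 0 < r <= 1 ->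
  (forall i, 0 <= x i) ->
  (forall t, 0 < t -> 0 <= \sum_i c i * resolvent_ratio t (x i)) ->
  0 <= \sum_i c i * x i `^ r.
Proof.
move=> /andP[r0]; rewrite le_eqVlt => /predU1P[->|r1] x0 cx;
  apply: sumr_ge0_approx => [i|e e0]; rewrite ?powR_ge0//.
  (* For [r = 1], [t * x / (x + t)] tends to [x] as [t] grows; its relative error [x / (x + t)] is
     at most [e] for this [t]. *)
  pose t := (\sum_i x i) / e + 1.
  have t0 : 0 < t by rewrite ltr_wpDl// divr_ge0 ?(ltW e0) ?sumr_ge0.
  exists (fun i => t * resolvent_ratio t (x i)) => [i|].
    have xi_le : x i <= \sum_i x i.
      by rewrite (bigD1 i)//= lerDl sumr_ge0.
    rewrite powRr1//.
    have xt0 : 0 < x i + t by rewrite ltr_wpDl.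
    have -> : t * resolvent_ratio t (x i) - x i = - (x i / (x i + t) * x i).
      by rewrite /resolvent_ratio; field; rewrite gt_eqF.
    rewrite normrN ger0_norm ?mulr_ge0 ?invr_ge0 ?(ltW xt0)// ler_wpM2r//.
    rewrite ler_pdivrMr// mulrDr ler_wpDl ?mulr_ge0 ?(ltW e0)//.
    rewrite /t mulrDr mulrCA divff ?gt_eqF// !mulr1.
    by rewrite (le_trans xi_le)// lerDl ltW.
  under eq_bigr do rewrite mulrCA.
  by rewrite -big_distrr/= mulr_ge0 ?cx// ltW.
pose w : R := (1 + e) `^ r^-1.
have w1 : 1 < w by rewrite powR_gt1 ?ltrDl ?invr_gt0.
have wr : w `^ r = 1 + e.
  by rewrite -powRrM mulVf ?gt_eqF// powRr1// addr_ge0// ltW.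
exists (fun i => lattice_power w (w `^ r) (x i) / lattice_power w (w `^ r) 1).
  move=> i; rewrite (_ : e = w `^ r - 1); last by rewrite wr; ring.
  by apply: lattice_power_approx => //; rewrite r0.
have v1 : 1 < w `^ r by rewrite wr ltrDl.
have vw : w `^ r < w by exact: powR_lt.
under eq_bigr do rewrite mulrA.
rewrite -big_distrl/= divr_ge0 ?(ltW (lattice_power1_gt0 _ _))//.
exact: lattice_power_cone.
Qed.

End PowerCone.

Local Open Scope sesquilinear_scope.

(** * Subspaces on which a matrix is bounded below *)

Section InnerProduct.
Variable C : numClosedFieldType.

Lemma trmxC_mul m n p (A : 'M[C]_(m, n)) (B : 'M[C]_(n, p)) :
  (A *m B) ^t* = B ^t* *m A ^t*.
Proof. by rewrite trmx_mul map_mxM. Qed.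

Lemma trmxC_add m n (A B : 'M[C]_(m, n)) : (A + B) ^t* = A ^t* + B ^t*.
Proof. by rewrite linearD map_mxD. Qed.

Lemma hermsymmx_trmxC n (A : 'M[C]_n) : A \is hermsymmx -> A ^t* = A.
Proof. by move=> /is_hermitianmxP; rewrite expr0 scale1r => <-. Qed.

Definition dot n (u v : 'cV[C]_n) : C := (u ^t* *m v) 0 0.

Lemma dotE n (u v : 'cV[C]_n) : dot u v = \sum_i (u i 0)^* * v i 0.
Proof. by rewrite /dot mxE; apply: eq_bigr => i _; rewrite !mxE. Qed.

Lemma dotDr n (u v w : 'cV[C]_n) : dot u (v + w) = dot u v + dot u w.
Proof. by rewrite /dot mulmxDr mxE. Qed.

Lemma dotDl n (u v w : 'cV[C]_n) : dot (v + w) u = dot v u + dot w u.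
Proof. by rewrite /dot trmxC_add mulmxDl mxE. Qed.

Lemma dotBr n (u v w : 'cV[C]_n) : dot u (v - w) = dot u v - dot u w.
Proof. by rewrite /dot mulmxBr !mxE. Qed.

Lemma dotC n (u v : 'cV[C]_n) : dot u v = (dot v u)^*.
Proof.
rewrite !dotE rmorph_sum; apply: eq_bigr => i _.
by rewrite rmorphM/= conjCK mulrC.
Qed.

Lemma dotBl n (u v w : 'cV[C]_n) : dot (v - w) u = dot v u - dot w u.
Proof. by rewrite dotC dotBr rmorphB/= -!dotC. Qed.

Lemma dotZr n (a : C) (u v : 'cV[C]_n) : dot u (a *: v) = a * dot u v.
Proof. by rewrite /dot -scalemxAr mxE. Qed.

Lemma dotZl n (a : C) (u v : 'cV[C]_n) : dot (a *: u) v = a^* * dot u v.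
Proof. by rewrite dotC dotZr rmorphM/= -dotC. Qed.

Lemma dot_mull m n (M : 'M[C]_(m, n)) u v : dot (M *m u) v = dot u (M ^t* *m v).
Proof. by rewrite /dot trmxC_mul mulmxA. Qed.

Lemma dot_mulr m n (M : 'M[C]_(m, n)) u v : dot u (M *m v) = dot (M ^t* *m u) v.
Proof. by rewrite dot_mull trmxCK. Qed.

Lemma dot_normE n (v : 'cV[C]_n) : dot v v = \sum_i `|v i 0| ^+ 2.
Proof. by rewrite dotE; apply: eq_bigr => i _; rewrite normCKC. Qed.

Lemma dot_ge0 n (v : 'cV[C]_n) : 0 <= dot v v.
Proof. by rewrite dot_normE sumr_ge0// => i _; rewrite exprn_ge0. Qed.

Lemma dot_eq0 n (v : 'cV[C]_n) : dot v v = 0 -> v = 0.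
Proof.
rewrite dot_normE => /eqP; rewrite psumr_eq0 => [/allP v0|i _]; last first.
  by rewrite exprn_ge0.
apply/matrixP => i j; rewrite ord1 mxE.
have := v0 i (mem_index_enum i).
by rewrite expf_eq0/= normr_eq0 => /eqP.
Qed.

Lemma dot_unitary m n (P : 'M[C]_(m, n)) (u v : 'cV[C]_n) :
  P ^t* *m P = 1%:M -> dot (P *m u) (P *m v) = dot u v.
Proof. by move=> P1; rewrite dot_mull mulmxA P1 mul1mx. Qed.

Lemma dot_col_mx m n (u u' : 'cV[C]_m) (v v' : 'cV[C]_n) :
  dot (col_mx u v) (col_mx u' v') = dot u u' + dot v v'.
Proof. by rewrite /dot tr_col_mx map_row_mx mul_row_col mxE. Qed.

Lemma row_mx_gram m n p (F : 'M[C]_(m, n)) (G : 'M[C]_(m, p)) :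
  row_mx F G *m (row_mx F G) ^t* = F *m F ^t* + G *m G ^t*.
Proof. by rewrite tr_row_mx map_col_mx mul_row_col. Qed.

(* In min-max terms, [stretches c j T] says that the j-th largest eigenvalue
   of [T^* T] is at least [c]; the subspace is given by a basis. *)
Definition stretches (c : C) (j : nat) m n (T : 'M[C]_(m, n)) :=
  exists U : 'M[C]_(n, j),
    (forall x : 'cV_j, U *m x = 0 -> x = 0) /\
    forall x : 'cV_j,
      c * dot (U *m x) (U *m x) <= dot (T *m (U *m x)) (T *m (U *m x)).

Lemma stretches_le c j m m' n (T : 'M[C]_(m, n)) (T' : 'M[C]_(m', n)) :
  (forall u, dot (T *m u) (T *m u) <= dot (T' *m u) (T' *m u)) ->
  stretches c j T -> stretches c j T'.
Proof.
by move=> TT' [U [Uinj UT]]; exists U; split=> // x; exact: le_trans (TT' _).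
Qed.

(* On the image of [T], expand [0 <= |T^* T u - c u|^2]. *)
Lemma stretches_adj c j m n (T : 'M[C]_(m, n)) : 0 < c ->
  stretches c j T -> stretches c j (T ^t*).
Proof.
move=> c0 [U [Uinj UT]]; exists (T *m U); split=> [x TUx|x].
  apply/Uinj/dot_eq0/eqP; rewrite eq_le dot_ge0 andbT.
  have := UT x; rewrite !mulmxA TUx [dot 0 0]/dot mulmx0 [X in _ <= X]mxE.
  by rewrite pmulr_rle0.
rewrite -!mulmxA; set u := U *m x.
have := dot_ge0 (T ^t* *m (T *m u) - c *: u).
rewrite dotBl !dotBr !dotZl !dotZr [dot _ u]dot_mull trmxCK.
rewrite -[dot u (_ *m _)]dot_mull (CrealP (gtr0_real c0)).
have : c * (c * dot u u) <= c * dot (T *m u) (T *m u) by rewrite ler_pM2l//; exact: UT.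
set a := dot (_ *m (_ *m _)) _; set b := dot (T *m u) _; set d := dot u u.
move=> h1 h2.
rewrite -subr_ge0 in h1; rewrite -subr_ge0.
have -> : a - c * b = a - c * b - (c * b - c * (c * d)) + (c * b - c * (c * d)).
  by ring.
exact: addr_ge0.
Qed.

(** On the subspace, [|M u|^2 - c^2 |u|^2 = |M u - c u|^2 + 2 c (<u, M u> - c |u|^2)], and both
    terms are nonnegative. *)
Lemma stretches_quad c j n (M : 'M[C]_n) : 0 < c -> M ^t* = M ->
  (exists U : 'M[C]_(n, j),
    (forall x : 'cV_j, U *m x = 0 -> x = 0) /\
    forall x : 'cV_j,
      c * dot (U *m x) (U *m x) <= dot (U *m x) (M *m (U *m x))) ->
  stretches (c ^+ 2) j M.
Proof.
move=> c0 Mh [U [Uinj UM]]; exists U; split=> // x; set u := U *m x.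
have := dot_ge0 (M *m u - c *: u).
rewrite dotBl !dotBr !dotZl !dotZr [dot _ u]dot_mull Mh (CrealP (gtr0_real c0)).
have := UM x; rewrite -/u -(ler_pM2l c0).
set a := dot (M *m u) _; set b := dot u (M *m u); set d := dot u u => h1 h2.
rewrite -subr_ge0 in h1; rewrite -subr_ge0.
have -> : a - c ^+ 2 * d = a - c * b - (c * b - c * (c * d)) + 2 * (c * b - c * (c * d)).
  by ring.
by rewrite addr_ge0// mulr_ge0// ler0n.
Qed.

Lemma wide_mx_kernel (m n : nat) (M : 'M[C]_(m, n)) : (m < n)%N ->
  exists2 x : 'cV[C]_n, x != 0 & M *m x = 0.
Proof.
move=> mn.
have /rowV0Pn[v] : kermx M^T != 0.
  rewrite -mxrank_eq0 mxrank_ker mxrank_tr -lt0n subn_gt0.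
  exact: leq_ltn_trans (rank_leq_row M) mn.
rewrite sub_kermx => /eqP vM v0; exists v^T.
  by apply: contra v0 => /eqP v0; rewrite -[v]trmxK v0 trmx0.
by apply: trmx_inj; rewrite trmx0 trmx_mul trmxK.
Qed.

(** The right side minus the left side is [<U v - w, P (U v - w)>]. *)
Lemma inverse_variational n (P U : 'M[C]_n) (v w : 'cV[C]_n) :
  P ^t* = P -> (forall u, 0 <= dot u (P *m u)) -> U ^t* = U -> P *m U = 1%:M ->
  dot w v + dot v w - dot w (P *m w) <= dot v (U *m v).
Proof.
move=> hP P0 hU PU; rewrite -subr_ge0.
have := P0 (U *m v - w); rewrite mulmxBr mulmxA PU mul1mx dotBl !dotBr.
rewrite [dot (U *m v) (P *m w)]dot_mulr hP mulmxA PU mul1mx.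
by rewrite dot_mull hU; congr (_ <= _); ring.
Qed.

(* Operator convexity of the inverse: [U + V >= 4 (P + Q)^-1]. *)
Lemma inverse_pair_ge n (P Q U V : 'M[C]_n) (x y : 'cV[C]_n) :
  P ^t* = P -> Q ^t* = Q ->
  (forall u, 0 <= dot u (P *m u)) -> (forall u, 0 <= dot u (Q *m u)) ->
  U ^t* = U -> V ^t* = V -> P *m U = 1%:M -> Q *m V = 1%:M ->
  (P + Q) *m y = 2 *: x ->
  2 * dot x y <= dot x (U *m x) + dot x (V *m x).
Proof.
move=> hP hQ P0 Q0 hU hV PU QV Ny; have yx : dot y x = dot x y.
  apply: (@mulfI _ (2 : C)); first by rewrite pnatr_eq0.
  rewrite -dotZr -Ny dot_mulr trmxC_add hP hQ Ny dotZl.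
  by rewrite rmorph_nat.
(* The common trial vector [y = 2 (P + Q)^-1 x] maximizes the sum of the two lower bounds. *)
have := lerD (inverse_variational x y hP P0 hU PU) (inverse_variational x y hQ Q0 hV QV).
rewrite addrACA -opprD -(dotDr y) -(mulmxDl P) Ny dotZr yx.
by apply: le_trans; rewrite le_eqVlt; apply/orP; left; apply/eqP; ring.
Qed.

End InnerProduct.

Local Open Scope complex_scope.

(** * Functional calculus and singular values *)

Section FunctionalCalculus.
Variable R : realType.
Local Notation C := R[i].

Lemma conj_real_complex (x : R) : Num.conj (x%:C : C) = x%:C.
Proof. by apply/CrealP; rewrite complex_real. Qed.

Lemma real_complexD (x y : R) : (x + y)%:C = x%:C + y%:C :> C.
Proof. exact: rmorphD. Qed.

Lemma real_complexM (x y : R) : (x * y)%:C = x%:C * y%:C :> C.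
Proof. exact: rmorphM. Qed.

Definition eigval n (A : 'M[C]_n) i : R := complex.Re (spectral_diag A 0 i).

(** Squared moduli of coordinates in the eigenbasis of [A], kept real so that quadratic forms of
    functions of [A] become real sums. *)
Definition spectral_weight n (A : 'M[C]_n) (v : 'cV[C]_n) i : R :=
  complex.Re (`|(spectralmx A *m v) i 0| ^+ 2).

Lemma spectral_weight_norm n (A : 'M[C]_n) v i :
  (spectral_weight A v i)%:C = `|(spectralmx A *m v) i 0| ^+ 2.
Proof. by apply: RRe_real; rewrite realX// normr_real. Qed.

Lemma spectral_weight_ge0 n (A : 'M[C]_n) v i : 0 <= spectral_weight A v i.
Proof. by rewrite -ler0c spectral_weight_norm exprn_ge0. Qed.

Lemma spectral_weight_eq0 n (A : 'M[C]_n) v i :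
  (spectralmx A *m v) i 0 = 0 -> spectral_weight A v i = 0.
Proof. by rewrite /spectral_weight => ->; rewrite normr0 expr0n. Qed.

Lemma spectralmx_adjK n (A : 'M[C]_n) : (spectralmx A) ^t* *m spectralmx A = 1%:M.
Proof. by rewrite -invmx_unitary ?spectral_unitarymx// mulVmx// spectral_unit. Qed.

Lemma spectralmxK_adj n (A : 'M[C]_n) : spectralmx A *m (spectralmx A) ^t* = 1%:M.
Proof. by rewrite -invmx_unitary ?spectral_unitarymx// mulmxV// spectral_unit. Qed.

Definition eigval_mx n (f : R -> R) (A : 'M[C]_n) : 'M[C]_n :=
  diag_mx (\row_i (f (eigval A i))%:C).

Lemma mxfuncalcE n (f : R -> R) (A : 'M[C]_n) :
  mxfuncalc f A = (spectralmx A) ^t* *m eigval_mx f A *m spectralmx A.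
Proof.
rewrite /mxfuncalc /eigval_mx; set d := map_mx _ _; set e := \row_i _.
have -> : d = e by apply/rowP => i; rewrite !mxE.
by rewrite (invmx_unitary (spectral_unitarymx A)).
Qed.

Lemma eigval_mx_trmxC n f (A : 'M[C]_n) : (eigval_mx f A) ^t* = eigval_mx f A.
Proof.
rewrite /eigval_mx tr_diag_mx map_diag_mx; set d := map_mx _ _.
suff -> : d = \row_i (f (eigval A i))%:C by [].
by apply/rowP => i; rewrite !mxE; exact: conj_real_complex.
Qed.

Lemma eigval_mxM n f g (A : 'M[C]_n) :
  eigval_mx f A *m eigval_mx g A = eigval_mx (fun x => f x * g x) A.
Proof.
rewrite /eigval_mx mulmx_diag; set d := \row_j _.
suff -> : d = \row_i (f (eigval A i) * g (eigval A i))%:C by [].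
by apply/rowP => i; rewrite !mxE rmorphM.
Qed.

Lemma eigval_mxD n f g (A : 'M[C]_n) :
  eigval_mx f A + eigval_mx g A = eigval_mx (fun x => f x + g x) A.
Proof.
rewrite /eigval_mx -linearD; set d := _ + _.
suff -> : d = \row_i (f (eigval A i) + g (eigval A i))%:C by [].
by apply/rowP => i; rewrite !mxE rmorphD.
Qed.

Lemma mxfuncalc_trmxC n f (A : 'M[C]_n) : (mxfuncalc f A) ^t* = mxfuncalc f A.
Proof.
by rewrite (mxfuncalcE f) !trmxC_mul trmxCK eigval_mx_trmxC mulmxA.
Qed.

Lemma mxfuncalcM n f g (A : 'M[C]_n) :
  mxfuncalc f A *m mxfuncalc g A = mxfuncalc (fun x => f x * g x) A.
Proof.
rewrite 3!mxfuncalcE -eigval_mxM !mulmxA.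
by rewrite -[_ *m spectralmx A *m _]mulmxA spectralmxK_adj mulmx1.
Qed.

Lemma mxfuncalcD n f g (A : 'M[C]_n) :
  mxfuncalc f A + mxfuncalc g A = mxfuncalc (fun x => f x + g x) A.
Proof. by rewrite 3!mxfuncalcE -eigval_mxD mulmxDr mulmxDl. Qed.

Lemma mxfuncalc_cst n c (A : 'M[C]_n) : mxfuncalc (fun=> c) A = (c%:C)%:M.
Proof.
rewrite mxfuncalcE.
have -> : eigval_mx (fun=> c) A = (c%:C)%:M.
  by apply/matrixP => i j; rewrite !mxE.
by rewrite scalar_mxC -mulmxA spectralmx_adjK mulmx1.
Qed.

Lemma eq_mxfuncalc n f g (A : 'M[C]_n) :
  (forall i, f (eigval A i) = g (eigval A i)) -> mxfuncalc f A = mxfuncalc g A.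
Proof.
move=> fg; rewrite 2!mxfuncalcE.
suff -> : eigval_mx f A = eigval_mx g A by [].
by rewrite /eigval_mx; apply/matrixP => i j; rewrite !mxE fg.
Qed.

Lemma mxfuncalc_id n (A : 'M[C]_n) : A \is hermsymmx -> mxfuncalc id A = A.
Proof.
move=> hA; rewrite [RHS](orthomx_spectralP (hermitian_normalmx hA)) /mxfuncalc.
set d := map_mx _ _; suff -> : d = spectral_diag A by [].
apply/rowP => i; rewrite mxE; apply: RRe_real.
exact: (mxOverP (hermitian_spectral_diag_real hA)).
Qed.

Lemma dot_mxfuncalc n f (A : 'M[C]_n) v :
  dot v (mxfuncalc f A *m v) =
  (\sum_i f (eigval A i) * spectral_weight A v i)%:C.
Proof.
rewrite mxfuncalcE -!mulmxA dot_mulr trmxCK dotE rmorph_sum.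
apply: eq_bigr => i _; rewrite rmorphM/= spectral_weight_norm.
by rewrite /eigval_mx mul_diag_mx !mxE normCKC mulrCA.
Qed.

Lemma dot_spectral_weight n (A : 'M[C]_n) v :
  dot v v = (\sum_i spectral_weight A v i)%:C.
Proof.
rewrite -(dot_unitary _ _ (spectralmx_adjK A)) dot_normE rmorph_sum.
by apply: eq_bigr => i _; rewrite /= spectral_weight_norm.
Qed.

Lemma psdmx_eigval_ge0 n (A : 'M[C]_n) i : psdmx A -> 0 <= eigval A i.
Proof.
move=> [hA A0].
(* The test vector is the i-th eigenvector, whose only nonzero spectral weight is the i-th. *)
have := A0 ((spectralmx A) ^t* *m delta_mx i 0).
rewrite -mulmxA -[X in 0 <= X]/(dot _ (A *m _)) -{2}(mxfuncalc_id hA).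
rewrite dot_mxfuncalc ler0c (bigD1 i)//= big1 => [|k ki].
  rewrite addr0 /spectral_weight mulmxA spectralmxK_adj mul1mx mxE !eqxx.
  by rewrite normr1 expr1n/= mulr1.
by rewrite spectral_weight_eq0 ?mulr0// mulmxA spectralmxK_adj mul1mx mxE (negbTE ki).
Qed.

Lemma psdmx_gram m n (X : 'M[C]_(m, n)) : psdmx (X ^t* *m X).
Proof.
split=> [|v]; first by apply/is_hermitianmxP; rewrite expr0 scale1r trmxC_mul trmxCK.
by rewrite -!mulmxA mulmxA -trmxC_mul; exact: dot_ge0.
Qed.

End FunctionalCalculus.

(** * Lower bounds on singular values from subspaces *)

Section SingularValues.
Variable R : realType.
Local Notation C := R[i].

(** Trades sorting for counting: in the non-increasing list, the entries that are at least [c] form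
    a prefix. The index [j] starts at 0, hence the strict inequality. *)
Lemma nth_sort_ge (s : seq R) (j : nat) (c : R) : (j < size s)%N ->
  (c <= nth 0 (sort (fun x y : R => y <= x) s) j) = (j < count (fun x => (c <= x)%R) s)%N.
Proof.
move=> js; set s' := sort _ s.
have s's : sorted (fun x y : R => y <= x) s'.
  by apply: sort_sorted => x y; exact: le_total.
have ge_trans : transitive (fun x y : R => y <= x).
  by move=> x y z yx zx; exact: le_trans yx.
have ge_refl : reflexive (fun x y : R => y <= x) by move=> x.
have js' : (j < size s')%N by rewrite size_sort.
have nth_mono := sorted_leq_nth ge_trans ge_refl 0 s's.
rewrite -(count_sort (fun x y : R => y <= x)) -/s'.
have [cj|jc] := lerP.
  apply/esym; rewrite -(cat_take_drop j.+1 s') count_cat.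
  apply: ltn_addr; rewrite (_ : count _ _ = j.+1)//.
  have sz : size (take j.+1 s') = j.+1 by rewrite size_take_min; apply/minn_idPl.
  rewrite -[RHS]sz; apply/eqP; rewrite -all_count; apply/(all_nthP 0) => k.
  rewrite sz ltnS => kj; rewrite nth_take//; apply: le_trans cj _.
  by apply: nth_mono; rewrite ?inE// (leq_ltn_trans kj).
apply/esym/negbTE; rewrite -leqNgt -(cat_take_drop j s') count_cat.
rewrite [X in (_ + X)%N](_ : _ = 0)%N ?addn0.
  by rewrite (leq_trans (count_size _ _))// size_take_min geq_minl.
apply/eqP; rewrite -leqn0 leqNgt -has_count; apply/(has_nthP 0) => -[k].
rewrite size_drop ltn_subRL nth_drop => kj.
rewrite leNgt => /negP; apply; apply: le_lt_trans jc.
by apply: nth_mono; rewrite ?inE ?leq_addr.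
Qed.

Lemma singular_value_ge n (X : 'M[C]_n) j c : (1 <= j <= n)%N ->
  (c <= singular_value X j) =
  (j <= #|[pred i | (c <= Num.sqrt (eigval (X ^t* *m X) i))%R]|)%N.
Proof.
move=> /andP[j1 jn].
rewrite /singular_value nth_sort_ge; last by rewrite size_map size_enum_ord prednK.
by rewrite prednK// count_map -size_filter cardE enumT.
Qed.

Lemma singular_value_ge0 n (X : 'M[C]_n) j : (1 <= j <= n)%N ->
  0 <= singular_value X j.
Proof.
move=> jn; rewrite singular_value_ge//.
rewrite (_ : #|_| = n); first by case/andP: jn.
by rewrite -[RHS]card_ord; apply: eq_card => i; rewrite !inE sqrtr_ge0.
Qed.

Lemma dot_gram m n (X : 'M[C]_(m, n)) v :
  dot (X *m v) (X *m v) =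
  (\sum_i eigval (X ^t* *m X) i * spectral_weight (X ^t* *m X) v i)%:C.
Proof.
rewrite dot_mull mulmxA -{1}(mxfuncalc_id (psdmx_gram X).1).
exact: (dot_mxfuncalc id).
Qed.

(* A basis of the [j]-dimensional subspace meets the span of the eigenvectors
   whose eigenvalue is less than [c ^+ 2]. *)
Lemma stretches_singular_value n (X : 'M[C]_n) j c : (1 <= j <= n)%N -> 0 < c ->
  stretches (c ^+ 2)%:C j X -> c <= singular_value X j.
Proof.
move=> jn c0 [U [Uinj UX]]; rewrite singular_value_ge//.
set G := X ^t* *m X; set I := [pred i | _]; rewrite leqNgt; apply/negP => Ij.
(* The coordinates along eigenvectors in [I] impose fewer than [j] equations, so some nonzero
   [U *m x] has none of them. *)
have [x x0 Ix] := wide_mx_kernel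
  (rowsub (fun k : 'I_#|I| => enum_val k) (spectralmx G *m U)) Ij.
have wI i : i \in I -> spectral_weight G (U *m x) i = 0.
  move=> iI; apply: spectral_weight_eq0; rewrite mulmxA.
  move/matrixP/(_ (enum_rank_in iI i) 0): Ix.
  rewrite [X in X = _ -> _]mxE [X in _ = X -> _]mxE => <-.
  by rewrite [LHS]mxE; apply: eq_bigr => k _; rewrite [in RHS]mxE enum_rankK_in.
have := UX x; rewrite (dot_gram X) (dot_spectral_weight G) -rmorphM lecR.
apply/negP; rewrite -ltNge.
have eig0 i : 0 <= eigval G i by apply: psdmx_eigval_ge0; exact: psdmx_gram.
(* The equality case is recorded because a strict inequality is needed for the sum: equality would
   make every weight, hence [U *m x], vanish. *)
have le i : eigval G i * spectral_weight G (U *m x) i <=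
            c ^+ 2 * spectral_weight G (U *m x) i ?= iff
              (spectral_weight G (U *m x) i == 0).
  have [iI|iI] := boolP (i \in I).
    by rewrite wI// !mulr0 eqxx; apply/leif_refl.
  have lt : eigval G i < c ^+ 2.
    by rewrite -(sqr_sqrtr (eig0 i)) ltr_pXn2r ?nnegrE ?sqrtr_ge0 ?(ltW c0)// ltNge.
  split; first by rewrite ler_wpM2r ?spectral_weight_ge0// ltW.
  rewrite -subr_eq0 -mulrBl mulf_eq0 orbC.
  by case: eqP => //= _; rewrite subr_eq0 lt_eqF.
have /leifP := leif_sum (fun i (_ : true) => le i).
case: ifPn => [/forallP w0 _|_ lt]; last by rewrite mulr_sumr.
case/eqP: x0; apply/Uinj/dot_eq0; rewrite (dot_spectral_weight G) big1 => // i _.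
exact/eqP/w0.
Qed.

End SingularValues.

(** * Off-diagonal blocks of a Gram matrix *)

Section SingularValueStretches.
Variable R : realType.
Local Notation C := R[i].

(* With [K = F1^* F2 = V |K|], the vectors [(V b, b)], for [b] in the span of
   the eigenvectors of [|K|] of eigenvalue at least [c], satisfy
   [|F1 V b + F2 b|^2 >= 4 Re <V b, K b> = 4 <b, |K| b>]. *)
Lemma singular_value_stretches m n (F1 F2 : 'M[C]_(m, n)) j c :
  (1 <= j <= n)%N -> 0 < c -> c <= singular_value (F1 ^t* *m F2) j ->
  stretches (2 * c)%:C j (row_mx F1 F2).
Proof.
move=> jn c0; set K := F1 ^t* *m F2; rewrite singular_value_ge//.
set G := K ^t* *m K; set I := [pred i | _] => jI.
pose f (k : 'I_j) : 'I_n := enum_val (widen_ord jI k).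
have f_inj : injective f.
  by move=> k l /enum_val_inj kl; apply: val_inj; move/(congr1 val): kl.
have fI k : f k \in I by exact: enum_valP.
pose Sel : 'M[C]_(n, j) := \matrix_(i, k) (i == f k)%:R.
pose U0 := (spectralmx G) ^t* *m Sel.
have PU0 x : spectralmx G *m (U0 *m x) = Sel *m x :> 'cV[C]_n.
  by rewrite !mulmxA spectralmxK_adj mul1mx.
have SelE (x : 'cV[C]_j) k : (Sel *m x) (f k) 0 = x k 0.
  rewrite mxE (bigD1 k)//= big1 ?addr0 => [|l lk].
    by rewrite mxE eqxx mul1r.
  by rewrite mxE (inj_eq f_inj) eq_sym (negbTE lk) mul0r.
have U0I x i : i \notin I -> spectral_weight G (U0 *m x) i = 0.
  move=> iI; apply: spectral_weight_eq0; rewrite PU0 mxE big1// => k _.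
  rewrite mxE (_ : (i == f k) = false) ?mul0r//.
  by apply: contraNF iI => /eqP ->.
have eig0 i : 0 <= eigval G i by apply: psdmx_eigval_ge0; exact: psdmx_gram.
(* [K *m mxfuncalc g G] is the partial isometry [V]; the inverse of 0 is 0, so the kernel of [K] is
   sent to 0. *)
pose g (x : R) := (Num.sqrt x)^-1.
have gG : mxfuncalc id G = G := mxfuncalc_id (psdmx_gram K).1.
exists (col_mx (K *m mxfuncalc g G *m U0) U0); split=> x.
  rewrite mul_col_mx => /(congr1 dsubmx); rewrite col_mxKd linear0 => U0x.
  apply/matrixP => k l; rewrite ord1 mxE -SelE -PU0 U0x mulmx0 mxE//.
have -> : col_mx (K *m mxfuncalc g G *m U0) U0 *m x =
    col_mx (K *m (mxfuncalc g G *m (U0 *m x))) (U0 *m x).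
  by rewrite mul_col_mx !mulmxA.
rewrite mul_row_col dot_col_mx.
set b := U0 *m x; set gb := mxfuncalc g G *m b.
have gGM h : mxfuncalc h G *m G = mxfuncalc (fun x => h x * x) G.
  by rewrite -[X in _ *m X = _]gG mxfuncalcM.
have dotK u v : dot (K *m u) (K *m v) = dot u (G *m v).
  by rewrite dot_mull (mulmxA (K ^t*) K).
have aKb : dot (K *m gb) (K *m b) =
    (\sum_i g (eigval G i) * eigval G i * spectral_weight G b i)%:C.
  rewrite dotK dot_mull mxfuncalc_trmxC (mulmxA (mxfuncalc g G)) gGM.
  exact: dot_mxfuncalc.
have aa : dot (K *m gb) (K *m gb) =
    (\sum_i g (eigval G i) * eigval G i * g (eigval G i) * spectral_weight G b i)%:C.
  rewrite dotK dot_mull mxfuncalc_trmxC (mulmxA (mxfuncalc g G)) gGM.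
  by rewrite (mulmxA (mxfuncalc _ G)) mxfuncalcM dot_mxfuncalc.
have bb := dot_spectral_weight G b.
have F12 : dot (F1 *m (K *m gb)) (F2 *m b) = dot (K *m gb) (K *m b).
  rewrite [LHS]dot_mull (mulmxA (F1 ^t*)); exact: erefl.
have F21 : dot (F2 *m b) (F1 *m (K *m gb)) = dot (K *m gb) (K *m b).
  by rewrite dotC F12 aKb conj_real_complex.
have := dot_ge0 (F1 *m (K *m gb) - F2 *m b).
rewrite dotBl !dotBr dotDl !dotDr F12 F21 => h.
apply: le_trans (_ : 4 * dot (K *m gb) (K *m b) <= _); last first.
  move: h; set p := dot (K *m gb) _; set q := dot (F1 *m _) _; set r := dot (F2 *m _) _.
  move=> h; rewrite -subr_ge0.
  have -> : q + p + (p + r) - 4 * p = q - p - (p - r) by ring.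
  exact: h.
rewrite aa bb aKb -!rmorphD/= -[4](rmorph_nat (real_complex R)) -!rmorphM/= lecR.
rewrite -big_split/= !mulr_sumr; apply: ler_sum => i _.
have [iI|iI] := boolP (i \in I); last by rewrite U0I// !mulr0 addr0 mulr0.
have ci : c <= Num.sqrt (eigval G i) by exact: iI.
have w0 := spectral_weight_ge0 G b i.
have s0 : 0 < Num.sqrt (eigval G i) := lt_le_trans c0 ci.
rewrite -(sqr_sqrtr (eig0 i)) /g sqrtr_sqr ger0_norm ?(ltW s0)//.
set sg := Num.sqrt _ in ci s0 *; set w := spectral_weight _ _ _ in w0 *.
have -> : sg^-1 * sg ^+ 2 * sg^-1 = 1 by field; rewrite gt_eqF.
have -> : sg^-1 * sg ^+ 2 = sg by field; rewrite gt_eqF.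
by nra.
Qed.

(** For [T = X^* [F G]], the off-diagonal block of [T^* T] is [F^* X X^* G]. *)
Lemma singular_value_stretches_row m n p (X : 'M[C]_(p, m)) (F G : 'M[C]_(p, n)) j c :
  (1 <= j <= n)%N -> 0 < c ->
  c <= singular_value (F ^t* *m (X *m X ^t* ) *m G) j ->
  stretches (2 * c)%:C j (X ^t* *m row_mx F G).
Proof.
move=> jn c0; have -> : F ^t* *m (X *m X ^t* ) *m G = (X ^t* *m F) ^t* *m (X ^t* *m G).
  by rewrite trmxC_mul trmxCK !mulmxA.
by rewrite mul_mx_row; exact: singular_value_stretches.
Qed.

End SingularValueStretches.

(** * The operator inequality *)

Section HeinzOperatorInequality.
Variable R : realType.
Local Notation C := R[i].

(** With [N = P + Q] and [w = 2 N^-1 v], [inverse_pair_ge] is applied to [v] and to [S v]. As [S]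
    commutes with [N], the trial vectors are [w] and [S w], and [2 t <v, w> + <S v, S w> = <v, N w>
    = 2 <v, v>]. *)
Lemma resolvent_pair_ge n (P Q U V S : 'M[C]_n) (t : R) (v : 'cV[C]_n) :
  0 < t -> P ^t* = P -> Q ^t* = Q ->
  (forall u, 0 <= dot u (P *m u)) -> (forall u, 0 <= dot u (Q *m u)) ->
  U ^t* = U -> V ^t* = V -> S ^t* = S ->
  P *m U = 1%:M -> Q *m V = 1%:M -> P + Q = ((2 * t)%:C)%:M + S *m S ->
  4 * dot v v <= (2 * t)%:C * (dot v (U *m v) + dot v (V *m v))
    + (dot (S *m v) (U *m (S *m v)) + dot (S *m v) (V *m (S *m v))).
Proof.
move=> t0 hP hQ P0 Q0 hU hV hS PU QV PQ.
have E0 : psdmx (S *m S) by rewrite -{1}hS; exact: psdmx_gram.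
set N := P + Q in PQ.
have [w Nw] : exists w, N *m w = 2 *: v.
  exists (mxfuncalc (fun x => 2 / (2 * t + x)) (S *m S) *m v).
  have -> : N = mxfuncalc (fun x => 2 * t + x) (S *m S).
    by rewrite PQ -(mxfuncalcD (fun=> 2 * t) id) mxfuncalc_cst mxfuncalc_id ?E0.1.
  rewrite mulmxA mxfuncalcM.
  rewrite (@eq_mxfuncalc _ _ _ (fun=> 2)) => [|i].
    by rewrite mxfuncalc_cst mul_scalar_mx rmorph_nat.
  by rewrite mulrC divfK// gt_eqF// ltr_pwDl ?mulr_gt0// psdmx_eigval_ge0.
have NS : N *m (S *m w) = 2 *: (S *m v).
  rewrite scalemxAr -Nw PQ !mulmxDl mulmxDr !mulmxA; congr (_ + _).
  by rewrite scalar_mxC.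
have h1 := inverse_pair_ge hP hQ P0 Q0 hU hV PU QV Nw.
have h2 := inverse_pair_ge hP hQ P0 Q0 hU hV PU QV NS.
have t2 : 0 <= (2 * t)%:C by rewrite ler0c mulr_ge0// ltW.
have := lerD (ler_wpM2l t2 h1) h2; rewrite mulrCA -mulrDr; apply: le_trans.
have -> : 4 * dot v v = 2 * (2 * dot v v) by rewrite mulrA -natrM.
have <- : (2 * t)%:C * dot v w + dot (S *m v) (S *m w) = 2 * dot v v.
  rewrite dot_mull hS mulmxA -(dotZr (2 * t)%:C) -(dotDr v) -mul_scalar_mx.
  by rewrite -mulmxDl -PQ Nw dotZr.
by [].
Qed.

Lemma powR_add (a x y : R) : 0 <= x -> 0 <= y -> a `^ (x + y) = a `^ x * a `^ y.
Proof.
move=> x0 y0; have [xy|xy] := eqVneq (x + y) 0; last by rewrite powRD// (negbTE xy).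
have [-> ->] : x = 0 /\ y = 0 by split; lra.
by rewrite addr0 powRr0 mulr1.
Qed.

(** Termwise, [x^2 / (x + t) = x - t + t^2 / (x + t)] and [x / (x + t) = 1 - t / (x + t)]. *)
Lemma sum_resolvent_ratio (I : finType) (x w w' : I -> R) (t : R) :
  0 < t -> (forall i, 0 <= x i) ->
  \sum_i (2 * (x i * w i) - w' i) * resolvent_ratio t (x i) =
  2 * (\sum_i x i * w i - t * \sum_i w i + t ^+ 2 * \sum_i (x i + t)^-1 * w i)
  - (\sum_i w' i - t * \sum_i (x i + t)^-1 * w' i).
Proof.
move=> t0 x0; rewrite !mulr_sumr -!sumrB -big_split/= mulr_sumr -sumrB.
apply: eq_bigr => i _; rewrite /resolvent_ratio; field.
by rewrite gt_eqF// ltr_wpDl.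
Qed.

Lemma heinz_operator_le n (A B S : 'M[C]_n) (t : R) (v : 'cV[C]_n) :
  psdmx A -> psdmx B -> 1 / 2 <= t <= 1 -> S ^t* = S ->
  S *m S = mxpowR A t + mxpowR B t ->
  dot (S *m v) ((mxpowR A (1 - t) + mxpowR B (1 - t)) *m (S *m v))
    <= 2 * dot v ((A + B) *m v).
Proof.
move=> A0 B0 /andP[t12]; rewrite le_eqVlt => /predU1P[->|t1] hS SS.
  (* At [t = 1] the exponent [r] would be 0, outside the range of [powR_cone]; here both sides are
     equal. *)
  have pow0 (M : 'M[C]_n) : mxpowR M (1 - 1) = 1%:M.
    rewrite subrr /mxpowR (@eq_mxfuncalc _ _ _ (fun=> 1)) ?mxfuncalc_cst// => i.
    by rewrite powRr0.
  have pow1 (M : 'M[C]_n) : psdmx M -> mxpowR M 1 = M.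
    move=> M0; rewrite -[RHS](mxfuncalc_id M0.1); apply: eq_mxfuncalc => i.
    by rewrite powRr1// psdmx_eigval_ge0.
  rewrite !pow1// in SS.
  rewrite !pow0 mulmxDl mul1mx dotDr dot_mull hS mulmxA SS.
  by rewrite le_eqVlt; apply/orP; left; apply/eqP; ring.
have t0 : 0 < t by lra.
have a0 i : 0 <= eigval A i by exact: psdmx_eigval_ge0.
have b0 i : 0 <= eigval B i by exact: psdmx_eigval_ge0.
pose r := (1 - t) / t.
have r01 : 0 < r <= 1.
  by rewrite divr_gt0 ?subr_gt0//= ler_pdivrMr//; lra.
(* The spectra of [P = A^t] and [Q = B^t] are merged into one family, so that one scalar inequality
   carries the whole operator inequality. *)
pose x (k : 'I_n + 'I_n) : R :=
  match k with inl i => eigval A i `^ t | inr i => eigval B i `^ t end.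
pose w u (k : 'I_n + 'I_n) : R :=
  match k with inl i => spectral_weight A u i | inr i => spectral_weight B u i end.
have x0 k : 0 <= x k by case: k => i; exact: powR_ge0.
have dotw u : 2 * dot u u = (\sum_k w u k)%:C.
  have -> : \sum_k w u k =
      \sum_i spectral_weight A u i + \sum_i spectral_weight B u i.
    by rewrite big_sumType.
  rewrite real_complexD (mulr_natl (dot u u) 2) mulr2n.
  by congr (_ + _); exact: dot_spectral_weight.
have dotwf f u : dot u ((mxfuncalc (fun a => f (a `^ t)) A
    + mxfuncalc (fun a => f (a `^ t)) B) *m u) = (\sum_k f (x k) * w u k)%:C.
  have -> : \sum_k f (x k) * w u k =
      \sum_i f (eigval A i `^ t) * spectral_weight A u i
      + \sum_i f (eigval B i `^ t) * spectral_weight B u i.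
    by rewrite big_sumType.
  rewrite real_complexD mulmxDl dotDr; congr (_ + _).
    exact: (dot_mxfuncalc (fun a => f (a `^ t)) A u).
  exact: (dot_mxfuncalc (fun a => f (a `^ t)) B u).
have cone : 0 <= \sum_k (2 * (x k * w v k) - w (S *m v) k) * x k `^ r.
  apply: powR_cone => // tau tau0; rewrite sum_resolvent_ratio//.
  pose P (M : 'M[C]_n) := mxfuncalc (fun a => a `^ t + tau) M.
  pose U (M : 'M[C]_n) := mxfuncalc (fun a => (a `^ t + tau)^-1) M.
  have PU M : P M *m U M = 1%:M.
    rewrite mxfuncalcM -(mxfuncalc_cst 1 M); apply: eq_mxfuncalc => i.
    by rewrite divff// gt_eqF// ltr_wpDl ?powR_ge0.
  have psd (M : 'M[C]_n) u : 0 <= dot u (P M *m u).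
    rewrite dot_mxfuncalc ler0c sumr_ge0// => i _.
    by rewrite mulr_ge0 ?spectral_weight_ge0// addr_ge0 ?powR_ge0// ltW.
  have PQ : P A + P B = ((2 * tau)%:C)%:M + S *m S.
    have PE M : P M = (tau%:C)%:M + mxpowR M t.
      by rewrite -(mxfuncalc_cst tau M) mxfuncalcD; apply: eq_mxfuncalc => i; exact: addrC.
    have -> : ((2 * tau)%:C)%:M = (tau%:C)%:M + (tau%:C)%:M :> 'M[C]_n.
      by rewrite -raddfD -rmorphD mulr_natl mulr2n.
    by rewrite SS !PE; exact: addrACA.
  have := resolvent_pair_ge v tau0 (mxfuncalc_trmxC _ A) (mxfuncalc_trmxC _ B)
    (psd A) (psd B) (mxfuncalc_trmxC _ A) (mxfuncalc_trmxC _ B) hS (PU A) (PU B) PQ.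
  rewrite -!dotDr -!mulmxDl !(dotwf (fun a => (a + tau)^-1)).
  have -> : 4 * dot v v = 2 * (2 * dot v v) by ring.
  rewrite dotw -[2](rmorph_nat (real_complex R)) -!rmorphM -rmorphD lecR/= => h.
  (* Both sides are [2 |S v|^2], as [S^2 = A^t + B^t]. This cancels the terms without resolvents and
     leaves [tau] times the inequality [h]. *)
  have Sv : \sum_k w (S *m v) k = 2 * \sum_k x k * w v k.
    apply: (@complexI R); rewrite -dotw rmorphM/= -(dotwf id).
    by rewrite rmorph_nat -SS -mulmxA [in RHS]dot_mulr hS.
  rewrite Sv.
  set N := \sum_k w v k in h *; set E := \sum_k x k * w v k in h *.
  set Fv := \sum_k _ * w v k in h *; set FS := \sum_k _ * w _ k in h *.
  rewrite (_ : _ - _ = tau * (2 * tau * Fv + FS - 2 * N)); last by ring.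
  by rewrite mulr_ge0 ?(ltW tau0)// subr_ge0.
have powr a : (a `^ t) `^ r = a `^ (1 - t) by rewrite -powRrM mulrC divfK ?gt_eqF.
have powr1 a : 0 <= a -> a `^ t * (a `^ t) `^ r = a.
  move=> age0; rewrite powr -powR_add ?(ltW t0) ?subr_ge0 ?(ltW t1)//.
  by rewrite (_ : t + (1 - t) = 1) ?powRr1//; ring.
have powE (M : 'M[C]_n) : mxpowR M (1 - t) = mxfuncalc (fun a => (a `^ t) `^ r) M.
  by apply: eq_mxfuncalc => i; rewrite powr.
have idE (M : 'M[C]_n) : psdmx M -> mxfuncalc (fun a => a `^ t * (a `^ t) `^ r) M = M.
  move=> M0; rewrite -[RHS](mxfuncalc_id M0.1); apply: eq_mxfuncalc => i.
  by rewrite powr1// psdmx_eigval_ge0.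
have lhsE : dot (S *m v) ((mxpowR A (1 - t) + mxpowR B (1 - t)) *m (S *m v)) =
    (\sum_k x k `^ r * w (S *m v) k)%:C.
  by rewrite !powE; exact: (dotwf (fun y => y `^ r)).
have rhsE : dot v ((A + B) *m v) = (\sum_k x k * x k `^ r * w v k)%:C.
  by rewrite -(dotwf (fun y => y * y `^ r)) (idE A A0) (idE B B0).
rewrite lhsE rhsE -[2](rmorph_nat (real_complex R)) -real_complexM lecR -subr_ge0.
move: cone; congr (_ <= _); rewrite mulr_sumr -sumrB.
by apply: eq_bigr => k _; ring.
Qed.

End HeinzOperatorInequality.

Lemma mxpowR_add (R : realType) n (M : 'M[R[i]]_n) (x y : R) : 0 <= x -> 0 <= y ->
  mxpowR M x *m mxpowR M y = mxpowR M (x + y).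
Proof.
by move=> x0 y0; rewrite mxfuncalcM; apply: eq_mxfuncalc => i; rewrite powR_add.
Qed.

Lemma mxpowR_trmxC (R : realType) n (M : 'M[R[i]]_n) (x : R) : (mxpowR M x) ^t* = mxpowR M x.
Proof. exact: mxfuncalc_trmxC. Qed.

(** * The singular value inequality *)

(* Keeps unification from comparing [mxpowR A x] and [mxpowR B x] by unfolding. *)
Local Opaque mxpowR singular_value.

Section HeinzSingularValues.
Variables (R : realType) (n : nat) (A B : 'M[R[i]]_n).
Hypotheses (A0 : psdmx A) (B0 : psdmx B).

Let pow_row (r : R) : 'M[R[i]]_(n, n + n) := row_mx (mxpowR A (r / 2)) (mxpowR B (r / 2)).

Let pow_row_gram r : 0 <= r ->
  pow_row r *m (pow_row r) ^t* = mxpowR A r + mxpowR B r.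
Proof.
move=> r0; have r20 : 0 <= r / 2 by rewrite divr_ge0.
have gram (M : 'M[R[i]]_n) :
    mxpowR M (r / 2) *m (mxpowR M (r / 2)) ^t* = mxpowR M r.
  by rewrite mxpowR_trmxC (mxpowR_add M r20 r20) -splitr.
by rewrite /pow_row row_mx_gram 2!gram.
Qed.

(** The matrix in the hypothesis is [A^(p/2) (A^q + B^q) B^(p/2)], an off-diagonal block of [T^* T]
    for [T = X_q^* X_p]. *)
Let stretches_pow_row p q j c :
  0 <= p -> 0 <= q -> (1 <= j <= n)%N -> 0 < c ->
  c <= singular_value (mxpowR A (p / 2 + q) *m mxpowR B (p / 2)
    + mxpowR A (p / 2) *m mxpowR B (q + p / 2)) j ->
  stretches (2 * c)%:C j ((pow_row q) ^t* *m pow_row p).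
Proof.
move=> p0 q0 jn c0 cj; have p20 : 0 <= p / 2 by rewrite divr_ge0.
apply: (singular_value_stretches_row jn c0).
have sandwich (F P Q G FP QG : 'M[R[i]]_n) : F *m P = FP -> Q *m G = QG ->
    F *m (P + Q) *m G = FP *m G + F *m QG.
  by move=> <- <-; rewrite mulmxDr mulmxDl mulmxA.
rewrite (mxpowR_trmxC A) (pow_row_gram q0).
by rewrite (sandwich _ _ _ _ _ _ (mxpowR_add A p20 q0) (mxpowR_add B q0 p20)).
Qed.

(** [X_t^*] may be replaced by [S], since [X_t X_t^* = S^2]. Passing to the adjoint [Y^* S] produces
    the form of [S (A^(1-t) + B^(1-t)) S], which [heinz_operator_le] bounds by that of
    [2 (A + B)]. *)
Let pow_row_singular_value t j c :
  1 / 2 <= t <= 1 -> (1 <= j <= n)%N -> 0 < c ->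
  stretches (2 * c)%:C j ((pow_row t) ^t* *m pow_row (1 - t)) ->
  c <= singular_value (A + B) j.
Proof.
move=> t12 jn c0; have [t0 t1] : 0 <= t /\ 0 <= 1 - t by split; lra.
set Y := pow_row (1 - t); pose E := mxpowR A t + mxpowR B t.
have E0 : psdmx E by rewrite /E -(pow_row_gram t0) -{1}[pow_row t]trmxCK; exact: psdmx_gram.
have [S hS SS] : exists2 S : 'M[R[i]]_n, S ^t* = S & S *m S = E.
  exists (mxfuncalc Num.sqrt E); first exact: mxfuncalc_trmxC.
  rewrite mxfuncalcM -[RHS](mxfuncalc_id E0.1); apply: eq_mxfuncalc => i.
  by rewrite -expr2 sqr_sqrtr// psdmx_eigval_ge0.
have c20 : 0 < (2 * c)%:C :> R[i] by rewrite ltcR mulr_gt0.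
have XS u : dot ((pow_row t) ^t* *m Y *m u) ((pow_row t) ^t* *m Y *m u) =
    dot (S *m Y *m u) (S *m Y *m u).
  rewrite -!(mulmxA _ Y u).
  rewrite (dot_mull S) hS (mulmxA S S) SS /E -(pow_row_gram t0) -mulmxA.
  by rewrite (dot_mulr (pow_row t)).
have XS_le u : dot ((pow_row t) ^t* *m Y *m u) ((pow_row t) ^t* *m Y *m u) <=
    dot (S *m Y *m u) (S *m Y *m u) by rewrite XS.
move=> /(stretches_le XS_le)/(stretches_adj c20) [U [Uinj US]].
apply: stretches_singular_value => //; rewrite rmorphXn.
apply: stretches_quad; first by rewrite ltcR.
  by rewrite trmxC_add (hermsymmx_trmxC A0.1) (hermsymmx_trmxC B0.1).
exists U; split=> // x; have := US x.
rewrite trmxC_mul hS -(mulmxA _ S) [dot (Y ^t* *m _) _]dot_mull trmxCK (mulmxA Y).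
rewrite (pow_row_gram t1) => le1.
have := le_trans le1 (heinz_operator_le (U *m x) A0 B0 t12 hS SS).
by rewrite rmorphM/= rmorph_nat -mulrA ler_pM2l// ltr0n.
Qed.

Lemma heinz_singular_value_le_half j s : (1 <= j <= n)%N -> 0 <= s <= 1 / 2 ->
  singular_value (mxpowR A s *m mxpowR B (1 - s)
                  + mxpowR A (1 - s) *m mxpowR B s) j
  <= singular_value (A + B) j.
Proof.
move=> jn /andP[s0 s12]; set Z := _ + _.
have [c0|c0] := lerP (singular_value Z j) 0.
  exact: le_trans c0 (singular_value_ge0 _ jn).
have ZE : Z = mxpowR A (2 * s / 2 + (1 - 2 * s)) *m mxpowR B (2 * s / 2)
    + mxpowR A (2 * s / 2) *m mxpowR B (1 - 2 * s + 2 * s / 2).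
  have -> : 2 * s / 2 = s by field.
  rewrite (_ : s + (1 - 2 * s) = 1 - s); last by ring.
  rewrite (_ : 1 - 2 * s + s = 1 - s); last by ring.
  exact: addrC.
have h : stretches (2 * singular_value Z j)%:C j
    ((pow_row (1 - 2 * s)) ^t* *m pow_row (2 * s)).
  have p0 : 0 <= 2 * s by lra.
  have q0 : 0 <= 1 - 2 * s by lra.
  by apply: (stretches_pow_row p0 q0 jn c0); rewrite -ZE; exact: lexx.
(* Of [1 - 2 * s] and [2 * s], the one that is at least 1/2 serves as [t]; when it is [2 * s], the
   adjoint exchanges the two factors. *)
have [s14|s14] := lerP s (1 / 4).
  have t12 : 1 / 2 <= 1 - 2 * s <= 1 by apply/andP; split; lra.
  apply: (pow_row_singular_value t12 jn c0).
  by rewrite (_ : 1 - (1 - 2 * s) = 2 * s); [exact: h|ring].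
have t12 : 1 / 2 <= 2 * s <= 1 by apply/andP; split; lra.
apply: (pow_row_singular_value t12 jn c0).
rewrite -[pow_row (1 - 2 * s)]trmxCK -trmxC_mul; apply: stretches_adj; last exact: h.
by rewrite ltcR mulr_gt0.
Qed.

End HeinzSingularValues.

Theorem theorem2 (R : realType) (n : nat) (A B : 'M[R[i]]_n) (j : nat) (s : R)
    (hn : (1 <= n)%N) (hA : psdmx A) (hB : psdmx B)
    (hj : (1 <= j <= n)%N) (hs : 0 <= s <= 1) :
  singular_value (mxpowR A s *m mxpowR B (1 - s)
                  + mxpowR A (1 - s) *m mxpowR B s) j
  <= singular_value (A + B) j.
Proof.
(* Replacing [s] by [1 - s] swaps the two summands, so [s <= 1 / 2] suffices. *)
have /andP[s0 s1] := hs; have [s12|s12] := lerP s (1 / 2).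
  by apply: (heinz_singular_value_le_half hA hB hj); rewrite s0.
have hs' : 0 <= 1 - s <= 1 / 2 by apply/andP; split; lra.
have le1 := heinz_singular_value_le_half hA hB hj hs'.
rewrite (_ : 1 - (1 - s) = s) in le1; last by ring.
by rewrite [X in singular_value X j <= _]addrC; exact: le1.
Qed.
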